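(* The set $\operatorname{trop}(\Sigma_n^* )$ equals the tropical convex hull of the set of symmetric $n\times n$ rational matrices of tropical rank one.
   Context: Tropical arithmetic on $\mathbb Q$: $a\oplus b=\min(a,b)$, $a\odot b=a+b$. Let $R=\bigcup_{m\ge1}\mathbb R((t^{1/m}))$ be the field of real Puiseux series, with valuation $\operatorname{val}$ (lowest exponent of $t$ with nonzero coefficient) and ordering $a>b$ iff the leading coefficient of $a-b$ is positive. $\Sigma_n^*$ is the set of symmetric $n\times n$ matrices over $R$ with no zero entries all of whose principal minors are nonnegative, and $\operatorname{trop}(\Sigma_n^* )=\{\operatorname{val}(A):A\in\Sigma_n^*\}$ (entrywise valuation). A matrix $[a_{ij}]$ has tropical rank one if $a_{ij}+a_{kl}=a_{il}+a_{kj}$ for all $i\neq k$, $j\neq l$. The tropical convex hull of a set $S$ of matrices is the set of all finite tropical linear combinations $c_1\odot M_1\oplus\cdots\oplus c_r\odot M_r$ with $c_k\in\mathbb Q$, $M_k\in S$, i.e. entrywise minima of the matrices $c_k+M_k$. *)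

(* Defs.v *)
From HB Require Import structures.
From mathcomp Require Import all_boot all_order all_algebra.
From mathcomp Require Import mathcomp_extra boolp classical_sets functions.
From mathcomp Require Import cardinality fsbigop reals.
From mathcomp Require Import zify lra ring.
Set Implicit Arguments.
Unset Strict Implicit.
Unset Printing Implicit Defensive.
Import Order.TTheory GRing.Theory Num.Theory.
Local Open Scope classical_set_scope.
Local Open Scope ring_scope.

Section LaurentConvolution.
Context {R : realFieldType}.
Implicit Types (f g h : rat -> R) (m : nat) (N : int) (q : rat).

(* [f] is the coefficient family of an element of R((t^{1/m})) of order at
   least N/m. *)
Definition laurent m N f : Prop :=
  forall q, f q != 0 -> exists2 k : int, N <= k & q = k%:~R / m%:R.

Definition puiseux_family f : Prop :=
  exists m N, (0 < m)%N /\ laurent m N f.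

(* For Puiseux families only finitely many terms are nonzero (a [\sum] over a
   set would be 0 otherwise). *)
Definition conv f g : rat -> R :=
  fun q => \sum_(a \in [set: rat]) f a * g (q - a).

Definition delta0 : rat -> R := fun q => (q == 0)%:R.

Lemma laurent_widen m d N N' f : (0 < d)%N -> (0 < m)%N -> N' <= N * d%:Z ->
  laurent m N f -> laurent (m * d) N' f.
Proof.
move=> d0 m0 NN' hf q /hf[k Nk ->]; exists (k * d%:Z).
  by apply: (le_trans NN'); rewrite ler_pM2r.
have m0' : m%:R != 0 :> rat by rewrite pnatr_eq0 -lt0n.
have d0' : d%:R != 0 :> rat by rewrite pnatr_eq0 -lt0n.
by rewrite natrM intrM /= -[d%:~R]/(d%:R); field; rewrite m0' d0'.
Qed.

Lemma laurent_common f g : puiseux_family f -> puiseux_family g ->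
  exists m n, [/\ (0 < m)%N, laurent m (- n%:Z) f & laurent m (- n%:Z) g].
Proof.
move=> [m [N [m0 hf]]] [m' [N' [m'0 hg]]].
exists (m * m')%N, (absz N * m' + absz N' * m)%N; split; first by rewrite muln_gt0 m0.
  by apply: (laurent_widen (N := N)) => //; nia.
rewrite mulnC; apply: (laurent_widen (N := N')) => //; nia.
Qed.

Lemma laurent_common3 f g h :
  puiseux_family f -> puiseux_family g -> puiseux_family h ->
  exists m n, [/\ (0 < m)%N, laurent m (- n%:Z) f,
    laurent m (- n%:Z) g & laurent m (- n%:Z) h].
Proof.
move=> /laurent_common/[apply] -[m [N [m0 hf hg]]] [m' [N' [m'0 hh]]].
exists (m * m')%N, (N * m' + absz N' * m)%N; split; first by rewrite muln_gt0 m0.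
- by apply: (laurent_widen (N := - N%:Z)) => //; nia.
- by apply: (laurent_widen (N := - N%:Z)) => //; nia.
rewrite mulnC; apply: (laurent_widen (N := N')) => //; nia.
Qed.

Lemma conv_seq f g q (s : seq rat) : uniq s ->
  (forall a, f a != 0 -> g (q - a) != 0 -> a \in s) ->
  conv f g q = \sum_(a <- s) f a * g (q - a).
Proof.
move=> us hs; rewrite /conv fsbig_supp.
apply: (fsbig_fwiden s) => // a /=.
  by move=> [_ /eqP]; rewrite mulf_eq0 negb_or => /andP[fa ga]; exact: hs.
by move=> [_ /=] h; apply: contrapT => h'; apply: h; split.
Qed.

Definition grid m (K : nat) : seq rat :=
  [seq (i%:Z - K%:Z)%:~R / m%:R | i <- iota 0 (K + K).+1].

Lemma grid_uniq m K : (0 < m)%N -> uniq (grid m K).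
Proof.
move=> m0; rewrite map_inj_uniq ?iota_uniq // => i j.
have m0' : m%:R != 0 :> rat by rewrite pnatr_eq0 -lt0n.
move=> /(congr1 (fun x => x * m%:R)); rewrite !divfK // => /intr_inj; lia.
Qed.

Lemma mem_grid m K (k : int) : `|k| <= K%:Z -> k%:~R / m%:R \in grid m K.
Proof.
move=> hk; apply/mapP; exists (absz (k + K%:Z)); first by rewrite mem_iota; lia.
by congr (_%:~R / _); lia.
Qed.

Lemma gridP m K q : q \in grid m K ->
  exists2 k : int, `|k| <= K%:Z & q = k%:~R / m%:R.
Proof.
move=> /mapP[i]; rewrite mem_iota => hi ->; exists (i%:Z - K%:Z) => //; lia.
Qed.

Lemma conv_grid m n (b : nat) (K : nat) f g q : (0 < m)%N ->
  laurent m (- n%:Z) f -> laurent m (- n%:Z) g ->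
  q * m%:R <= b%:R -> (n + b <= K)%N ->
  conv f g q = \sum_(a <- grid m K) f a * g (q - a).
Proof.
move=> m0 hf hg qb nK; apply: conv_seq; first exact: grid_uniq.
move=> a /hf[k hk ->] /hg[k' hk' e]; apply: mem_grid.
have m0' : m%:R != 0 :> rat by rewrite pnatr_eq0 -lt0n.
have e' : q * m%:R = (k + k')%:~R.
  have -> : q = k%:~R / m%:R + k'%:~R / m%:R by rewrite -e; ring.
  by rewrite -mulrDl divfK // intrD.
have : k + k' <= b%:Z by rewrite -(ler_int rat) -e'.
lia.
Qed.

Lemma conv_neq0 f g q : conv f g q != 0 ->
  exists2 a, f a != 0 & g (q - a) != 0.
Proof.
move=> /eqP h; apply: contrapT => h'; apply: h; apply: fsbig1 => a _.
apply/eqP; rewrite mulf_eq0; apply: contra_notT h'.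
by rewrite negb_or => /andP[fa ga]; exists a.
Qed.

Lemma laurent_conv m N N' f g : laurent m N f -> laurent m N' g ->
  laurent m (N + N') (conv f g).
Proof.
move=> hf hg q /conv_neq0[a /hf[k hk ->] /hg[k' hk' e]].
exists (k + k'); first exact: lerD.
by rewrite intrD mulrDl -e; ring.
Qed.

Lemma archi_rat q : exists b : nat, q <= b%:R.
Proof.
exists (Num.truncn q).+1; apply: ltW; exact: Num.Theory.truncnS_gt.
Qed.

Lemma convC f g : conv f g = conv g f.
Proof.
apply/funext => q; rewrite /conv (reindex_fsbigT (fun a => q - a)).
  by apply: eq_fsbigr => a _; rewrite mulrC; congr (g _ * _); ring.
by exists (fun a => q - a) => a; ring.
Qed.

Lemma convA f g h :
  puiseux_family f -> puiseux_family g -> puiseux_family h ->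
  conv f (conv g h) = conv (conv f g) h.
Proof.
move=> pf pg ph; have [m [n [m0 hf hg hh]]] := laurent_common3 pf pg ph.
have low u : laurent m (- n%:Z) u -> laurent m (- (n + n)%N%:Z) u.
  by move=> hu q /hu[k hk ->]; exists k => //; lia.
have hfg : laurent m (- (n + n)%N%:Z) (conv f g).
  by have := laurent_conv hf hg; congr laurent; lia.
have hgh : laurent m (- (n + n)%N%:Z) (conv g h).
  by have := laurent_conv hg hh; congr laurent; lia.
apply/funext => q; have [b qb] := archi_rat (q * m%:R).
set K := (n + n + b + n)%N; set K2 := (n + n + K + b)%N.
have m0' : m%:R != 0 :> rat by rewrite pnatr_eq0 -lt0n.
rewrite (conv_grid (K := K2) m0 (low _ hf) hgh qb); last by lia.
rewrite (conv_grid (K := K) m0 hfg (low _ hh) qb); last by lia.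
transitivity (\sum_(c <- grid m K) \sum_(a <- grid m K2)
    f a * (g (c - a) * h (q - c))); last first.
  apply: eq_big_seq => c /gridP[k hk ec].
  rewrite (conv_grid (K := K2) (b := K) m0 hf hg) ?mulr_suml; last by lia.
    by apply: eq_bigr => a _; rewrite mulrA.
  by rewrite ec divfK // -[K%:R]/(K%:Z%:~R) ler_int; lia.
rewrite exchange_big /=; apply: eq_bigr => a _.
rewrite -mulr_sumr; have [->|fa] := eqVneq (f a) 0; first by rewrite !mul0r.
congr (_ * _); have [k hk ea] := hf _ fa.
rewrite (conv_seq (s := [seq c - a | c <- grid m K])).
- by rewrite big_map; apply: eq_bigr => c _; congr (_ * h _); ring.
- by rewrite map_inj_uniq ?grid_uniq //; exact: addIr.
move=> c /hg[k' hk' ec] /hh[k'' hk'' e].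
apply/mapP; exists (c + a); last by ring.
rewrite ea ec -mulrDl -intrD; apply: mem_grid.
have e' : q * m%:R = (k + k' + k'')%:~R.
  have -> : q = k%:~R / m%:R + k'%:~R / m%:R + k''%:~R / m%:R.
    by rewrite -e -ea -ec; ring.
  by rewrite -!mulrDl divfK // !intrD.
have : k + k' + k'' <= b%:Z by rewrite -(ler_int rat) -e'.
rewrite /K; lia.
Qed.

Lemma conv1l f : conv delta0 f = f.
Proof.
apply/funext => q; rewrite (conv_seq (s := [:: 0])) //.
  by rewrite big_seq1 /delta0 eqxx mul1r subr0.
by move=> a; rewrite /delta0 inE; case: (a == 0); rewrite ?eqxx.
Qed.

Lemma convDl f g h :
  puiseux_family f -> puiseux_family g -> puiseux_family h ->
  conv (fun q => f q + g q) h = (fun q => conv f h q + conv g h q).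
Proof.
move=> pf pg ph; have [m [n [m0 hf hg hh]]] := laurent_common3 pf pg ph.
have hfg : laurent m (- n%:Z) (fun q => f q + g q).
  move=> q; have [->|fq _] := eqVneq (f q) 0; last exact: hf.
  by rewrite add0r; exact: hg.
apply/funext => q; have [b qb] := archi_rat (q * m%:R).
rewrite !(conv_grid (K := (n + b)%N) m0 _ hh qb) // -big_split /=.
by apply: eq_bigr => a _; rewrite mulrDl.
Qed.

Lemma puiseux_family0 : puiseux_family (fun=> 0).
Proof. by exists 1%N, 0; split=> // q; rewrite eqxx. Qed.

Lemma puiseux_family1 : puiseux_family delta0.
Proof.
exists 1%N, 0; split=> // q; rewrite /delta0.
by have [->|_] := eqVneq q 0; [exists 0|rewrite eqxx].
Qed.

Lemma puiseux_familyD f g : puiseux_family f -> puiseux_family g ->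
  puiseux_family (fun q => f q + g q).
Proof.
move=> /laurent_common/[apply] -[m [n [m0 hf hg]]]; exists m, (- n%:Z).
split=> // q; have [->|fq _] := eqVneq (f q) 0; last exact: hf.
by rewrite add0r; exact: hg.
Qed.

Lemma puiseux_familyN f : puiseux_family f -> puiseux_family (fun q => - f q).
Proof.
by move=> [m [N [m0 hf]]]; exists m, N; split=> // q; rewrite oppr_eq0; exact: hf.
Qed.

Lemma puiseux_familyM f g : puiseux_family f -> puiseux_family g ->
  puiseux_family (conv f g).
Proof.
move=> /laurent_common/[apply] -[m [n [m0 hf hg]]].
by exists m, (- n%:Z - n%:Z); split=> //; exact: laurent_conv.
Qed.

Lemma puiseux_family_order f : puiseux_family f -> (exists q, f q != 0) ->
  exists2 v, f v != 0 & forall q, f q != 0 -> v <= q.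
Proof.
move=> [m [N [m0 hf]]] [q0 fq0].
have m0' : 0 < m%:R :> rat by rewrite ltr0n.
pose P := [pred i : nat | f ((i%:Z + N)%:~R / m%:R) != 0].
have exP : exists i, P i.
  have [k hk eq0] := hf _ fq0; exists (absz (k - N)) => /=.
  by rewrite (_ : (absz (k - N))%:Z + N = k) -?eq0 //; lia.
case: (ex_minnP exP) => i /= Pi mini.
exists ((i%:Z + N)%:~R / m%:R) => // q fq; have [k hk eq] := hf _ fq.
have : P (absz (k - N)) by rewrite /= (_ : (absz (k - N))%:Z + N = k) -?eq //; lia.
move=> /mini ik; rewrite eq ler_pM2r ?invr_gt0 // ler_int; lia.
Qed.

Lemma conv_inv f : puiseux_family f -> (exists q, f q != 0) ->
  exists2 g, puiseux_family g & conv g f = delta0.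
Proof.
move=> pf /(puiseux_family_order pf)[v fv minv].
have [m [N [m0 hf]]] := pf.
have m0' : m%:R != 0 :> rat by rewrite pnatr_eq0 -lt0n.
have [k0 hk0 ev] := hf _ fv.
pose c i := f (v + i%:R / m%:R).
have c0 : c 0%N != 0 by rewrite /c mul0r addr0.
pose step (s : seq R) :=
  ((size s == 0%N)%:R - \sum_(i < size s) s`_i * c (size s - i)%N) / c 0%N.
pose S n := iter n (fun s => rcons s (step s)) [::].
have szS n : size (S n) = n by elim: n => //= n IH; rewrite size_rcons IH.
pose d i := (S i.+1)`_i.
have Sd n i : (i < n)%N -> (S n)`_i = d i.
  elim: n => // n IH; rewrite ltnS leq_eqVlt => /orP[/eqP->//|lt].
  by rewrite /S iterS -/(S n) nth_rcons szS lt IH.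
have dc n : \sum_(i < n.+1) d i * c (n - i)%N = (n == 0%N)%:R.
  rewrite big_ord_recr /= subnn {2}/d /S iterS -/(S n) nth_rcons szS ltnn eqxx.
  rewrite /step szS divfK //.
  under [X in _ - X]eq_bigr => i _ do rewrite Sd //.
  by rewrite addrC subrK.
pose isn q := (q + v) * m%:R \is a Num.nat.
pose g q := if isn q then d (Num.truncn ((q + v) * m%:R)) else 0.
have gE (i : nat) : g (i%:R / m%:R - v) = d i.
  by rewrite /g /isn subrK divfK // natr_nat natrK.
have gP q : g q != 0 -> exists i : nat, q = i%:R / m%:R - v.
  rewrite /g; case: ifP; rewrite ?eqxx // => /natrP[i e] _; exists i.
  by rewrite -e mulfK // addrK.
exists g.
  exists m, (- k0); split=> // q /gP[i ->]; exists (i%:Z - k0); first by lia.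
  by rewrite ev intrB mulrBl.
have fP q : f q != 0 -> exists i : nat, q = v + i%:R / m%:R.
  move=> fq; have [k hk eq] := hf _ fq; exists (absz (k - k0)).
  have : k0 <= k.
    by rewrite -(ler_int rat) -(@ler_pM2r _ m%:R^-1) ?invr_gt0 ?ltr0n // -eq -ev minv.
  move=> kk; rewrite ev eq -mulrDl -[_%:R as X in _ + X]/(_%:Z%:~R) -intrD.
  by congr (_%:~R / _); lia.
apply/funext => q; rewrite /delta0.
have [qn|qn] := boolP (q * m%:R \is a Num.nat); last first.
  transitivity (0 : R).
    apply/eqP; apply: contraNT qn => /conv_neq0[a /gP[i ->] /fP[j e]].
    have -> : q * m%:R = (i + j)%:R; last exact: natr_nat.
    rewrite natrD -(divfK m0' (i%:R + j%:R)); congr (_ * _).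
    rewrite mulrDl; lra.
  by case: eqVneq qn => // ->; rewrite mul0r rpred0.
have [n en] := natrP qn.
have eq : q = n%:R / m%:R by rewrite -en mulfK.
rewrite (conv_seq (s := [seq i%:R / m%:R - v | i <- iota 0 n.+1])).
- rewrite big_map -[iota 0 n.+1]/(index_iota 0 n.+1) big_mkord.
  have -> : (q == 0) = (n == 0%N).
    by rewrite eq mulf_eq0 invr_eq0 (negbTE m0') orbF pnatr_eq0.
  rewrite -dc; apply: eq_bigr => i _; rewrite gE /c; congr (_ * f _).
  by rewrite eq natrB -1?ltnS // mulrBl; ring.
- rewrite map_inj_uniq ?iota_uniq // => i j /addIr.
  move=> /(congr1 (fun x => x * m%:R)); rewrite !divfK // => /eqP.
  by rewrite eqr_nat => /eqP.
move=> a /gP[i ->] /fP[j e]; apply/mapP; exists i => //.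
have : q * m%:R = (i + j)%:R.
  rewrite natrD -(divfK m0' (i%:R + j%:R)); congr (_ * _).
  by rewrite mulrDl; lra.
rewrite en => /eqP; rewrite eqr_nat mem_iota => /eqP ->; lia.
Qed.

End LaurentConvolution.

(* A real Puiseux series a = \sum_q a_q t^q is the family q |-> a_q. *)
Record puiseux (R : realFieldType) := Puiseux {
  pcoef :> rat -> R;
  _ : puiseux_family pcoef }.

Section PuiseuxField.
Context {R : realFieldType}.
Local Notation P := (puiseux R).
Implicit Types a b c : P.

Lemma pcoefP a : puiseux_family a. Proof. by case: a. Qed.

Lemma pcoef_inj a b : (forall q, a q = b q) -> a = b.
Proof.
case: a b => [f pf] [g pg] /= /funext fg; rewrite fg in pf *.
by congr Puiseux; exact: Prop_irrelevance.
Qed.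

HB.instance Definition _ := gen_eqMixin P.
HB.instance Definition _ := gen_choiceMixin P.

Definition pzero : P := Puiseux puiseux_family0.
Definition pone : P := Puiseux puiseux_family1.
Definition padd a b : P := Puiseux (puiseux_familyD (pcoefP a) (pcoefP b)).
Definition popp a : P := Puiseux (puiseux_familyN (pcoefP a)).
Definition pmul a b : P := Puiseux (puiseux_familyM (pcoefP a) (pcoefP b)).

Lemma paddA : associative padd.
Proof. by move=> a b c; apply: pcoef_inj => q /=; rewrite addrA. Qed.
Lemma paddC : commutative padd.
Proof. by move=> a b; apply: pcoef_inj => q /=; rewrite addrC. Qed.
Lemma padd0 : left_id pzero padd.
Proof. by move=> a; apply: pcoef_inj => q /=; rewrite add0r. Qed.
Lemma paddN : left_inverse pzero popp padd.
Proof. by move=> a; apply: pcoef_inj => q /=; rewrite addNr. Qed.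

HB.instance Definition _ := GRing.isZmodule.Build P paddA paddC padd0 paddN.

Lemma pmulA : associative pmul.
Proof. by move=> a b c; apply: pcoef_inj => q /=; rewrite convA //; exact: pcoefP. Qed.
Lemma pmulC : commutative pmul.
Proof. by move=> a b; apply: pcoef_inj => q /=; rewrite convC. Qed.
Lemma pmul1 : left_id pone pmul.
Proof. by move=> a; apply: pcoef_inj => q /=; rewrite conv1l. Qed.
Lemma pmulDl : left_distributive pmul padd.
Proof. by move=> a b c; apply: pcoef_inj => q /=; rewrite convDl //; exact: pcoefP. Qed.
Lemma pone_neq0 : pone != pzero.
Proof.
apply/eqP => /(congr1 (fun a : P => a 0)) /= /eqP.
by rewrite /delta0 eqxx oner_eq0.
Qed.

HB.instance Definition _ :=
  GRing.Zmodule_isComNzRing.Build P pmulA pmulC pmul1 pmulDl pone_neq0.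

Lemma pcoef0 q : (0 : P) q = 0. Proof. by []. Qed.
Lemma pcoef1 q : (1 : P) q = (q == 0)%:R. Proof. by []. Qed.
Lemma pcoefD a b q : (a + b) q = a q + b q. Proof. by []. Qed.
Lemma pcoefN a q : (- a) q = - a q. Proof. by []. Qed.
Lemma pcoefM a b q : (a * b) q = \sum_(r \in [set: rat]) a r * b (q - r).
Proof. by []. Qed.

Lemma puiseux_neq0P a : reflect (exists q, a q != 0) (a != 0).
Proof.
apply: (iffP idP) => [/eqP a0|[q]].
  apply: contrapT => h; apply: a0; apply: pcoef_inj => q; apply/eqP.
  by apply: contra_notT h => aq; exists q.
by apply: contraNneq => ->.
Qed.

Definition pinv a : P := xget 0 [set b | b * a = 1].

Lemma pmulVf a : a != 0 -> pinv a * a = 1.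
Proof.
move=> /puiseux_neq0P a0; have [g pg e] := conv_inv (pcoefP a) a0.
apply: (@xgetPex _ 0 [set b | b * a = 1]); exists (Puiseux pg).
by apply: pcoef_inj => q; rewrite pcoef1 /= e.
Qed.

Lemma pinv0 : pinv 0 = 0.
Proof.
by apply: xgetPN => b /= /eqP; rewrite mulr0 eq_sym oner_eq0.
Qed.

HB.instance Definition _ := GRing.ComNzRing_isField.Build P pmulVf pinv0.

(* The lowest exponent with nonzero coefficient; [pval 0] is a junk value. *)
Definition pval a : rat :=
  xget 0 [set q | a q != 0 /\ forall r, a r != 0 -> q <= r].

Definition plead a : R := a (pval a).

Lemma pvalP a : a != 0 -> plead a != 0 /\ forall q, a q != 0 -> pval a <= q.
Proof.
move=> /puiseux_neq0P /(puiseux_family_order (pcoefP a))[v av minv].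
by apply: (@xgetPex _ 0 [set q | a q != 0 /\ forall r, a r != 0 -> q <= r]);
  exists v.
Qed.

Lemma pvalE a v : a v != 0 -> (forall q, a q != 0 -> v <= q) -> pval a = v.
Proof.
move=> av minv; apply: xget_unique => [//|w [aw minw]].
by apply/eqP; rewrite eq_le minw // minv.
Qed.

Lemma pcoef_lt_val a q : q < pval a -> a q = 0.
Proof.
have [->//|/pvalP[_ h]] := eqVneq a 0.
by rewrite ltNge; apply: contraNeq => /h.
Qed.

Lemma plead0 : plead 0 = 0. Proof. by []. Qed.

Lemma plead_eq0 a : (plead a == 0) = (a == 0).
Proof. by have [->|/pvalP[/negbTE]] := eqVneq a 0; rewrite ?plead0 ?eqxx. Qed.

Lemma pvalN a : pval (- a) = pval a.
Proof.
have [->|/pvalP[h1 h2]] := eqVneq a 0; first by rewrite oppr0.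
by apply: pvalE; rewrite ?pcoefN ?oppr_eq0 // => q; rewrite pcoefN oppr_eq0; exact: h2.
Qed.

Lemma pleadN a : plead (- a) = - plead a.
Proof. by rewrite /plead pvalN. Qed.

Lemma pcoefM_val a b : (a * b) (pval a + pval b) = plead a * plead b.
Proof.
rewrite [LHS](conv_seq (s := [:: pval a])) //.
  by rewrite big_seq1 /plead; congr (_ * b _); ring.
move=> q aq bq; have qa : pval a <= q.
  by rewrite leNgt; apply: contraNN aq => /pcoef_lt_val/eqP.
have : pval b <= pval a + pval b - q.
  by rewrite leNgt; apply: contraNN bq => /pcoef_lt_val/eqP.
by rewrite inE => qb; rewrite eq_le qa andbT; lra.
Qed.

Lemma pvalM a b : a != 0 -> b != 0 -> pval (a * b) = pval a + pval b.
Proof.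
move=> a0 b0; apply: pvalE.
  by rewrite pcoefM_val mulf_neq0 ?plead_eq0.
move=> q /conv_neq0[r ar br].
have := (pvalP a0).2 _ ar; have := (pvalP b0).2 _ br; lra.
Qed.

Lemma pleadM a b : plead (a * b) = plead a * plead b.
Proof.
have [->|a0] := eqVneq a 0; first by rewrite mul0r !plead0 mul0r.
have [->|b0] := eqVneq b 0; first by rewrite mulr0 !plead0 mulr0.
by rewrite {1}/plead pvalM // pcoefM_val.
Qed.

Definition plt a b : bool := 0 < plead (b - a).
Definition ple a b : bool := (a == b) || plt a b.
Definition pnorm a : P := if plt a 0 then - a else a.

Lemma plt0 a : plt 0 a = (0 < plead a). Proof. by rewrite /plt subr0. Qed.

Lemma plt0N a : plt a 0 = (plead a < 0).
Proof. by rewrite /plt sub0r pleadN oppr_gt0. Qed.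

Lemma plead_gt0_add a b : 0 < plead a -> 0 < plead b -> pval a <= pval b ->
  0 < plead (a + b).
Proof.
move=> a0 b0 vab.
have h : 0 < (a + b) (pval a).
  rewrite pcoefD ltr_pwDl //; move: vab; rewrite le_eqVlt => /orP[/eqP ->|].
    exact: ltW.
  by move=> /pcoef_lt_val ->.
rewrite /plead (pvalE (v := pval a)) ?gt_eqF // => q; rewrite pcoefD.
by rewrite leNgt; apply: contraNN => qa; rewrite !pcoef_lt_val ?addr0 //; lra.
Qed.

Lemma plt0_add a b : plt 0 a -> plt 0 b -> plt 0 (a + b).
Proof.
rewrite !plt0 => a0 b0; case: (leP (pval a) (pval b)) => vab.
  exact: plead_gt0_add.
by rewrite addrC plead_gt0_add // ltW.
Qed.

Lemma plt0_mul a b : plt 0 a -> plt 0 b -> plt 0 (a * b).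
Proof. by rewrite !plt0 pleadM; exact: mulr_gt0. Qed.

Lemma plt0_ngt0 a : plt 0 a -> ~~ plt a 0.
Proof. by rewrite plt0 plt0N => /ltW; rewrite leNgt. Qed.

Lemma psub_gt0 a b : plt 0 (b - a) = plt a b.
Proof. by rewrite /plt subr0. Qed.

Lemma plt0_total a : a != 0 -> plt 0 a || plt a 0.
Proof. by rewrite plt0 plt0N -plead_eq0; case: ltgtP. Qed.

Lemma pnormN a : pnorm (- a) = pnorm a.
Proof.
rewrite /pnorm !plt0N pleadN oppr_lt0 opprK.
case: ltgtP => // /eqP; rewrite ?(eq_sym 0) plead_eq0 => /eqP ->.
by rewrite oppr0.
Qed.

Lemma pge0_norm a : ple 0 a -> pnorm a = a.
Proof.
rewrite /pnorm /ple => /orP[/eqP <-|/plt0_ngt0 /negbTE -> //].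
by rewrite oppr0; case: ifP.
Qed.

Lemma ple_def a b : ple a b = (a == b) || plt a b. Proof. by []. Qed.

HB.instance Definition _ := Num.IntegralDomain_isLtReal.Build P
  plt0_add plt0_mul plt0_ngt0 psub_gt0 plt0_total pnormN pge0_norm ple_def.

Lemma puiseux_ltE a b : (a < b) = (0 < plead (b - a)). Proof. by []. Qed.

End PuiseuxField.

Definition principal_submx (F : Type) n (I : {set 'I_n}) (A : 'M[F]_n) :
    'M[F]_#|I| :=
  mxsub (@enum_val _ (mem I)) (@enum_val _ (mem I)) A.

Definition Sigma_star (R : realFieldType) n : set 'M[puiseux R]_n :=
  [set A | [/\ A^T = A, forall i j, A i j != 0 &
            forall I : {set 'I_n}, 0 <= \det (principal_submx I A)]].

Definition trop (R : realFieldType) n (S : set 'M[puiseux R]_n) :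
    set 'M[rat]_n :=
  [set map_mx pval A | A in S].

Definition trop_rank_one n (A : 'M[rat]_n) : Prop :=
  forall i k j l, i != k -> j != l -> A i j + A k l = A i l + A k j.

(* The rational tropical semiring has no +oo, so only combinations of at least
   one matrix make sense; the k = 0 term seeds the minimum. *)
Definition trop_comb n r (c : 'I_r.+1 -> rat) (M : 'I_r.+1 -> 'M[rat]_n) :
    'M[rat]_n :=
  \matrix_(i, j)
    \big[Num.min/(c ord0 + M ord0 i j)]_(k < r.+1) (c k + M k i j).

Definition trop_hull n (S : set 'M[rat]_n) : set 'M[rat]_n :=
  [set A | exists r (c : 'I_r.+1 -> rat) (M : 'I_r.+1 -> 'M[rat]_n),
     (forall k, S (M k)) /\ A = trop_comb c M].

(* Main.v *)
From mathcomp Require Import perm lra ring.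
Require Import Defs.
From mathcomp Require Import all_boot all_order all_algebra.
From mathcomp Require Import boolp classical_sets reals.
Set Implicit Arguments.
Unset Strict Implicit.
Unset Printing Implicit Defensive.
Import Order.TTheory GRing.Theory Num.Theory.
Local Open Scope classical_set_scope.
Local Open Scope ring_scope.

(** Both sets equal the set of symmetric matrices [B] with
    [B i i + B j j <= 2 * B i j]. For the valuation this inequality is read off
    the 2x2 principal minors, and it passes from symmetric tropical rank one
    matrices, where it is an equality, to minima. Conversely, each pair
    [(i, j)] gives a vector [x] with [B k l <= x k + x l] for all [k, l],
    [B i i = 2 * x i] and [B i j = x i + x j]. The rank one matrices
    [x k + x l] have minimum [B]. The vectors [t^(x i) e_i + t^(x j) e_j] have
    a Gram matrix with valuation [B], and Gram matrices have nonnegative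
    principal minors. *)

(** * Gram determinants over an ordered domain *)

Section Gram.
Context {F : realDomainType} {I : finType}.

(* Expanding by multilinearity gives the determinant as a sum over [f] of
   [\prod_i v i (f i)] times a determinant that is alternating in [f];
   averaging over the permutations of the arguments of [f] turns the product
   into the same determinant. *)
Lemma fact_det_gram n (v : 'I_n -> I -> F) :
  n`!%:R * \det (\matrix_(i, j) \sum_k v i k * v j k) =
  \sum_(f : {ffun 'I_n -> I}) (\det (\matrix_(i, j) v j (f i))) ^+ 2.
Proof.
pose d (f : {ffun 'I_n -> I}) := \det (\matrix_(i, j) v j (f i)).
have detE : \det (\matrix_(i, j) \sum_k v i k * v j k) =
    \sum_(f : {ffun 'I_n -> I}) (\prod_i v i (f i)) * d f.
  transitivity (\sum_(s : 'S_n) \sum_(f : {ffun 'I_n -> I})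
      (-1) ^+ s * \prod_i (v i (f i) * v (s i) (f i))).
    apply: eq_bigr => s _; rewrite -mulr_sumr; congr (_ * _).
    rewrite -(bigA_distr_bigA (fun i k => v i k * v (s i) k)).
    by apply: eq_bigr => i _; rewrite mxE.
  rewrite exchange_big; apply: eq_bigr => f _; rewrite mulr_sumr.
  apply: eq_bigr => s _; rewrite big_split mulrCA; congr (_ * (_ * _)).
  by apply: eq_bigr => i _; rewrite mxE.
have permE (s : 'S_n) : \det (\matrix_(i, j) \sum_k v i k * v j k) =
    \sum_(f : {ffun 'I_n -> I}) (-1) ^+ s * (\prod_i v i (f (s i))) * d f.
  pose h (s : 'S_n) (f : {ffun 'I_n -> I}) := [ffun i => f (s i)].
  have hK : cancel (h s) (h s^-1%g).
    by move=> f; apply/ffunP => i; rewrite !ffunE permKV.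
  have hK' : cancel (h s^-1%g) (h s).
    by move=> f; apply/ffunP => i; rewrite !ffunE permK.
  rewrite detE (reindex (h s)) /=; last by exists (h s^-1%g) => f _.
  apply: eq_bigr => f _.
  have -> : d (h s f) = (-1) ^+ s * d f.
    rewrite /d -det_perm -det_mulmx -row_permE; congr (\det _).
    by apply/matrixP => i j; rewrite !mxE ffunE.
  rewrite mulrCA mulrA; congr (_ * _ * _).
  by apply: eq_bigr => i _; rewrite ffunE.
(* The factor [n!] becomes one copy of the determinant for each permutation [s], and each copy is
   expanded by its own [permE s]. *)
rewrite -(card_Sn n) -cardsT mulr_natl -sumr_const.
under eq_bigr => s _ do rewrite (permE s).
rewrite exchange_big; apply: eq_bigr => f _.
rewrite -mulr_suml expr2; congr (_ * _).
rewrite -det_tr; apply: eq_big => [s|s _]; first by rewrite !inE.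
by congr (_ * _); apply: eq_bigr => i _; rewrite !mxE.
Qed.

(** A positive multiple of the determinant is a sum of squares. *)
Lemma det_gram_ge0 n (v : 'I_n -> I -> F) :
  0 <= \det (\matrix_(i, j) \sum_k v i k * v j k).
Proof.
have n0 : 0 < n`!%:R :> F by rewrite ltr0n fact_gt0.
rewrite -(pmulr_rge0 _ n0) fact_det_gram.
by apply: sumr_ge0 => f _; exact: sqr_ge0.
Qed.

End Gram.

(** * Principal minors of size two *)

(** The size is a variable [m] because [#|[set i; j]|] is only provably 2. Either order in which [f]
    lists [i] and [j] gives the same value. *)
Lemma det_mxsub2 (F : comNzRingType) n m (f : 'I_m -> 'I_n) (i j : 'I_n)
    (A : 'M[F]_n) : m = 2 -> injective f -> i != j ->
  (forall k, f k \in [set i; j]%SET) ->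
  \det (mxsub f f A) = A i i * A j j - A i j * A j i.
Proof.
move=> m2; subst m => finj ij fij.
have -> : \det (mxsub f f A) = A (f 0) (f 0) * A (f 1) (f 1)
    - A (f 0) (f 1) * A (f 1) (f 0).
  rewrite (expand_det_row _ ord0) !big_ord_recl big_ord0 /cofactor !det_mx11.
  rewrite !mxE /= /bump /=.
  rewrite (_ : lift ord0 0 = 1 :> 'I_2); last exact: val_inj.
  rewrite (_ : lift 1 0 = 0 :> 'I_2); last exact: val_inj.
  by ring.
have := fij 0; have := fij 1; have : f 0 != f 1 by rewrite (inj_eq finj).
rewrite !inE => f01 /orP[]/eqP e1 /orP[]/eqP e0; rewrite e0 e1 ?eqxx // in f01 *.
by ring.
Qed.

Lemma det_principal2 (F : comNzRingType) n (i j : 'I_n) (A : 'M[F]_n) :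
  i != j ->
  \det (principal_submx [set i; j]%SET A) = A i i * A j j - A i j * A j i.
Proof.
move=> ij; apply: det_mxsub2 => //.
- by rewrite cards2 ij.
- exact: enum_val_inj.
by move=> k; exact: enum_valP.
Qed.

(** * Valuations of Puiseux series *)

Section Valuation.
Context {R : realFieldType}.
Implicit Types a b : puiseux R.

(** If [b] had the larger valuation, [b - a] would have the negative leading coefficient
    [- plead a]. *)
Lemma pval_le_homo a b : 0 < a -> a <= b -> pval b <= pval a.
Proof.
move=> a0; rewrite le_eqVlt => /orP[/eqP ->//|ab].
rewrite leNgt; apply/negP => vab.
have ca : (b - a) (pval a) = - plead a.
  by rewrite pcoefD pcoefN (pcoef_lt_val vab) sub0r.
have la : 0 < plead a by move: a0; rewrite puiseux_ltE subr0.
move: ab; rewrite puiseux_ltE /plead (pvalE (v := pval a)).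
- by rewrite ca oppr_gt0 ltNge (ltW la).
- by rewrite ca oppr_eq0 gt_eqF.
move=> q; rewrite pcoefD pcoefN leNgt; apply: contraNN => qa.
by rewrite (pcoef_lt_val qa) (pcoef_lt_val (lt_trans qa vab)) subr0.
Qed.

Lemma puiseux_family_monomial (e : rat) :
  puiseux_family (fun q => (q == e)%:R : R).
Proof.
exists `|denq e|%N, (numq e); split; first by rewrite absz_gt0 denq_neq0.
move=> q; have [->|_] := eqVneq q e; last by rewrite eqxx.
move=> _; exists (numq e) => //.
by rewrite -[X in _ / X]/(_%:Z%:~R) absz_denq divq_num_den.
Qed.

Definition monomial (e : rat) : puiseux R :=
  Puiseux (puiseux_family_monomial e).

Lemma monomialD (e e' : rat) : monomial (e + e') = monomial e * monomial e'.
Proof.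
apply: pcoef_inj => q; rewrite pcoefM /=.
rewrite -[RHS]/(conv (monomial e) (monomial e') q) (conv_seq (s := [:: e])) //.
  rewrite big_seq1 /= eqxx mul1r; congr (_%:R); congr nat_of_bool.
  by apply/eqP/eqP; lra.
by move=> a /=; rewrite inE; case: (a == e); rewrite ?eqxx.
Qed.

Lemma pcoef_sum (I : finType) (P : pred I) (u : I -> puiseux R) q :
  (\sum_(k | P k) u k) q = \sum_(k | P k) u k q.
Proof. exact: (big_morph (fun a : puiseux R => a q)). Qed.

(** All coefficients are nonnegative, so nothing cancels at the lowest exponent. *)
Lemma pval_sum_monomial (I : finType) (P : pred I) (e : I -> rat) v :
  (forall k, P k -> v <= e k) -> (exists2 k, P k & e k = v) ->
  \sum_(k | P k) monomial (e k) != 0 /\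
  pval (\sum_(k | P k) monomial (e k)) = v.
Proof.
move=> ve [k0 Pk0 ek0].
have cv : (\sum_(k | P k) monomial (e k)) v != 0.
  rewrite pcoef_sum (bigD1 k0) //= ek0 eqxx gt_eqF // ltr_pwDl //.
  by apply: sumr_ge0 => k _; rewrite ler0n.
split; first by apply/puiseux_neq0P; exists v.
apply: pvalE => // q; rewrite pcoef_sum leNgt; apply: contraNN => qv.
rewrite big1 // => k /ve vk /=; rewrite lt_eqF //; exact: lt_le_trans vk.
Qed.

End Valuation.

(** * Realizing the tropical inequality in both sets *)

Definition trop_psd n (B : 'M[rat]_n) : Prop :=
  B^T = B /\ forall i j, B i i + B j j <= 2 * B i j.

Section TropicalPsd.
Context {n : nat} (B : 'M[rat]_n).

Definition entry_bound : rat := \sum_i \sum_j `|B i j|.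

Lemma le_entry_bound i j : `|B i j| <= entry_bound.
Proof.
rewrite /entry_bound (bigD1 i) //= (bigD1 j) //= -addrA lerDl.
by rewrite addr_ge0 ?sumr_ge0 // => k _; rewrite sumr_ge0.
Qed.

(* Off [p], any value large enough to dominate [B] would do. *)
Definition pair_vec (p : 'I_n * 'I_n) (k : 'I_n) : rat :=
  if k == p.1 then B p.1 p.1 / 2
  else if k == p.2 then B p.1 p.2 - B p.1 p.1 / 2
  else 3 * entry_bound.

Definition in_pair (p : 'I_n * 'I_n) (k : 'I_n) : bool :=
  (k == p.1) || (k == p.2).

Lemma pair_vec_attained i j : in_pair (i, j) i && in_pair (i, j) j /\
  pair_vec (i, j) i + pair_vec (i, j) j = B i j.
Proof.
rewrite /in_pair /pair_vec /= !eqxx orbT; split=> //.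
by have [->|_] := eqVneq j i; lra.
Qed.

Hypothesis psdB : trop_psd B.

(** For [k], [l] in the pair [(i, j)] equality holds, except for [k = l = j], which is [hB i j].
    Otherwise [3 * entry_bound] suffices, since values on the pair are at least
    [- 3 / 2 * entry_bound]. *)
Lemma le_pair_vec p k l : B k l <= pair_vec p k + pair_vec p l.
Proof.
have [symB hB] := psdB; case: p => i j; rewrite /pair_vec /=.
have sB a b : B a b = B b a by rewrite -[in LHS]symB mxE.
have := le_entry_bound k l; have := le_entry_bound i j.
have := le_entry_bound i i; have := hB i j; have := sB i j.
rewrite !ler_norml => ? ? /andP[? ?] /andP[? ?] /andP[? ?].
case: (eqVneq k i) => [?|_]; [subst k|case: (eqVneq k j) => [?|_]; [subst k|]];
  (case: (eqVneq l i) => [?|_]; [subst l|case: (eqVneq l j) => [?|_]; [subst l|]]);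
  lra.
Qed.

Lemma trop_hull_psd :
  trop_hull [set A : 'M[rat]_n | A^T = A /\ trop_rank_one A] B.
Proof.
have [symB _] := psdB.
(* For [n = 0] there are no pairs, but [B] itself vacuously has rank one. *)
have [i0 _|n0] := pickP (fun _ : 'I_n => true); last first.
  exists 0%N, (fun=> 0), (fun=> B); split=> [_|].
    by split=> // i; have := n0 i.
  by apply/matrixP => i; have := n0 i.
pose pairs := enum {: 'I_n * 'I_n}.
(* The last index lies past the end of [pairs]; there the default of [nth] repeats the pair
   [(i0, i0)], which is harmless. *)
pose p (k : 'I_(size pairs).+1) := nth (i0, i0) pairs k.
pose M k := \matrix_(i, j) (pair_vec (p k) i + pair_vec (p k) j).
exists (size pairs), (fun=> 0), M; split=> [k|].
  split; first by apply/matrixP => i j; rewrite !mxE addrC.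
  by move=> i a j b _ _; rewrite !mxE; ring.
apply/matrixP => i j; rewrite mxE; apply: le_anti; apply/andP; split.
  by apply: le_bigmin => [|k _]; rewrite add0r mxE le_pair_vec.
have lt_ij : (index (i, j) pairs < (size pairs).+1)%N by rewrite ltnS index_size.
apply: le_trans (bigmin_le _ (Ordinal lt_ij) _) _.
rewrite add0r mxE /p /= nth_index ?mem_enum //.
by rewrite (pair_vec_attained i j).2.
Qed.

Lemma trop_Sigma_star_psd (R : realFieldType) : trop (@Sigma_star R n) B.
Proof.
have [symB _] := psdB.
(* [v k p] is coordinate [k] of the vector of the pair [p], and [A] is the Gram matrix of the rows
   of [v]. *)
pose v k p : puiseux R :=
  if in_pair p k then monomial (pair_vec p k) else 0.
pose A := \matrix_(k, l) \sum_p v k p * v l p.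
have AE k l : A k l = \sum_(p | in_pair p k && in_pair p l)
    monomial (pair_vec p k + pair_vec p l).
  rewrite mxE [RHS]big_mkcond; apply: eq_bigr => p _; rewrite /v monomialD.
  by case: (in_pair p k); case: (in_pair p l); rewrite ?mul0r ?mulr0.
have valA k l : A k l != 0 /\ pval (A k l) = B k l.
  rewrite AE; apply: pval_sum_monomial => [p _|]; first exact: le_pair_vec.
  by exists (k, l); have [? ?] := pair_vec_attained k l.
exists A; last by apply/matrixP => k l; rewrite mxE; have [] := valA k l.
split=> [|k l|I].
- by apply/matrixP => k l; rewrite !mxE; apply: eq_bigr => p _; rewrite mulrC.
- by have [] := valA k l.
have -> : principal_submx I A = \matrix_(i, j) \sum_p
    v (@enum_val _ (mem I) i) p * v (@enum_val _ (mem I) j) p.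
  by apply/matrixP => i j; rewrite !mxE.
exact: det_gram_ge0.
Qed.

End TropicalPsd.

(** * Necessity of the tropical inequality *)

Lemma Sigma_star_trop_psd (R : realFieldType) n (A : 'M[puiseux R]_n) :
  Sigma_star A -> trop_psd (map_mx pval A).
Proof.
move=> [symA nzA minorA]; split.
  by apply/matrixP => i j; rewrite !mxE -[in RHS]symA mxE.
move=> i j; rewrite !mxE; have [<-|ij] := eqVneq i j; first lra.
have Aji : A j i = A i j by rewrite -[in LHS]symA mxE.
have := minorA [set i; j]%SET; rewrite det_principal2 // subr_ge0 Aji => le_sq.
(* Nonzero entries make the square strictly positive, as the order reversal by [pval] requires. *)
have sq_gt0 : 0 < A i j * A i j by rewrite -expr2 exprn_even_gt0 // nzA.
have := pval_le_homo sq_gt0 le_sq; rewrite !pvalM //.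
by move=> h; rewrite mulr_natl mulr2n.
Qed.

(** In each summand the [(i, j)] entry is the average of the two diagonal entries, hence at least
    the average of their minima [x] and [y]. *)
Lemma hull_trop_psd n (B : 'M[rat]_n) :
  trop_hull [set A : 'M[rat]_n | A^T = A /\ trop_rank_one A] B -> trop_psd B.
Proof.
move=> [r [c [M [rk1 ->]]]].
have symM k i j : M k j i = M k i j.
  by have [symM _] := rk1 k; rewrite -[in LHS]symM mxE.
split; first by apply/matrixP => i j; rewrite !mxE symM; under eq_bigr do rewrite symM.
move=> i j; rewrite !mxE mulrC -ler_pdivrMr //.
set x := \big[_/_]_(_ < _) _; set y := \big[_/_]_(_ < _) _.
have h k : (x + y) / 2 <= c k + M k i j.
  have xk : x <= c k + M k i i.
    exact: (bigmin_le _ k (fun k => c k + M k i i)).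
  have yk : y <= c k + M k j j.
    exact: (bigmin_le _ k (fun k => c k + M k j j)).
  have : M k i i + M k j j = M k i j + M k i j.
    have [<-//|ij] := eqVneq i j.
    by have [_ rk] := rk1 k; rewrite (rk i j i j) // symM.
  lra.
exact: le_bigmin.
Qed.

Theorem theorem4p2 (R : realType) (n : nat) :
  trop (@Sigma_star R n) =
  trop_hull [set A : 'M[rat]_n | A^T = A /\ trop_rank_one A].
Proof.
apply/seteqP; split=> [_ [A /Sigma_star_trop_psd psdA <-]|B /hull_trop_psd psdB].
  exact: trop_hull_psd.
exact: trop_Sigma_star_psd.
Qed.
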